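(* Let $\Omega\subset\mathbb{R}^n$ be a bounded open set. Let $\mathcal{R}:L^2(\Omega)\to[0,\infty]$ be convex and lower semicontinuous on $L^2(\Omega)$, vanish exactly on the constant functions, and have a domain $\{u\in L^2(\Omega):\mathcal{R}(u)<\infty\}$ that is dense in $L^2(\Omega)$. For $\alpha\in(0,\infty)$ set $\mathcal{R}_\alpha=\alpha\mathcal{R}$. Then, for every $\alpha\in[0,\infty]$, the Mosco-limit below exists and $$\overline{\mathcal{R}}_\alpha:=\mathrm{Mosc}(L^2)\text{-}\lim_{\alpha'\to\alpha}\mathcal{R}_{\alpha'}=\begin{cases}\mathcal{R}_\alpha&\text{for }\alpha\in(0,\infty),\\ 0&\text{for }\alpha=0,\\ \chi_C&\text{for }\alpha=\infty,\end{cases}$$ where $C:=\{u\in L^2(\Omega):u\text{ is constant}\}$ and $\chi_C(u)=0$ if $u\in C$, $\chi_C(u)=\infty$ if $u\in L^2(\Omega)\setminus C$.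
   Context: Mosco-convergence: for $\mathcal{F}_k,\mathcal{F}:L^2(\Omega)\to[0,\infty]$, $\mathcal{F}=\mathrm{Mosc}(L^2)\text{-}\lim_k\mathcal{F}_k$ means: (liminf inequality) whenever $u_k\rightharpoonup u$ weakly in $L^2(\Omega)$, $\mathcal{F}(u)\le\liminf_k\mathcal{F}_k(u_k)$; and (limsup inequality) for every $u\in L^2(\Omega)$ there is a sequence $u_k\to u$ strongly in $L^2(\Omega)$ with $\mathcal{F}(u)\ge\limsup_k\mathcal{F}_k(u_k)$. The statement $\mathrm{Mosc}(L^2)\text{-}\lim_{\alpha'\to\alpha}\mathcal{R}_{\alpha'}=\mathcal{F}$ means that $\mathrm{Mosc}(L^2)\text{-}\lim_k\mathcal{R}_{\alpha_k}=\mathcal{F}$ for every sequence $(\alpha_k)_k\subset(0,\infty)$ with $\alpha_k\to\alpha$ in $[0,\infty]$. *)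

(* Defs.v *)
From HB Require Import structures.
From mathcomp Require Import all_boot all_order all_algebra.
From mathcomp Require Import all_classical all_reals all_analysis.
From mathcomp Require Import measurable_realfun.

Set Implicit Arguments.
Unset Strict Implicit.
Unset Printing Implicit Defensive.
Import Order.TTheory GRing.Theory Num.Theory numFieldNormedType.Exports.

Local Open Scope classical_set_scope.
Local Open Scope ring_scope.

(* R^n with the Borel sigma-algebra generated by its open sets. *)
Notation borel_rV R n := (g_sigma_algebraType (@open 'rV[R]_n)).

Lemma open_measurable_rV (R : realType) (n : nat) (A : set 'rV[R]_n) :
  open A -> measurable (A : set (borel_rV R n)).
Proof. exact: sub_sigma_algebra. Qed.

Section measurable_rV.
Context (R : realType) (n : nat).

Lemma measurable_coord_rV (i : 'I_n) :
  measurable_fun setT (fun x : borel_rV R n => x ord0 i : measurableTypeR R).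
Proof.
apply: (measurability _ (RGenOpens.measurableE R)).
move=> _ [_ [a [b [-> <-]]]]; rewrite setTI.
apply: open_measurable_rV; apply: open_comp; last exact: interval_open.
by move=> x _; exact: coord_continuous.
Qed.

Lemma measurable_fun_rV d (T : measurableType d) (f : T -> borel_rV R n) :
  (forall i, measurable_fun setT (fun t => f t ord0 i : measurableTypeR R)) ->
  measurable_fun setT f.
Proof.
move=> mf; apply: (@measurability _ _ _ (borel_rV R n) _ _ open) => //.
move=> _ [U oU <-].
pose r (k : nat) : R := k.+1%:R^-1.
pose q (p : 'rV[rat]_n) : 'rV[R]_n := map_mx ratr p.
pose P (pk : 'rV[rat]_n * nat) := ball (q pk.1) (r pk.2) `<=` U.
have r0 k : 0 < r k by rewrite invr_gt0.
have -> : U = \bigcup_pk (if `[< P pk >] then ball (q pk.1) (r pk.2) else set0).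
  apply/seteqP; split => [x Ux|x [pk _]]; last by case: asboolP => //= qU; exact: qU.
  have /nbhs_ballP[e /= e0 eU] : nbhs x U by exact: open_nbhs_nbhs.
  have [k ke] : exists k, r k < e / 2.
    have := @near_infty_natSinv_lt R (PosNum (divr_gt0 e0 (ltr0Sn _ 1))).
    by move=> [k _ /(_ k (leqnn k))] ke; exists k.
  have /choice[p px] : forall i, exists p : rat, ratr p \in `](x ord0 i - r k), (x ord0 i + r k)[.
    by move=> i; apply: rat_in_itvoo; rewrite ltrD2l gtrN.
  have qx : ball (q (\row_i p i)) (r k) x.
    split => // i j; rewrite !mxE ord1 /ball/= distrC ltr_distlC.
    by have := px j; rewrite in_itv.
  exists (\row_i p i, k) => //=; case: asboolP => //= nP; case: nP => y qy.
  apply: eU; apply: (@le_ball _ _ _ (r k + r k)); last exact: ball_triangle (ball_sym qx) qy.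
  by rewrite (splitr e); apply/ltW/ltrD.
rewrite preimage_bigcup setI_bigcupr.
apply: countable_bigcupT_measurable => [|pk]; first exact/countableP.
rewrite setTI; case: ifPn => _; last by rewrite preimage_set0.
have -> : ball (q pk.1) (r pk.2) =
    \bigcap_(i in [set: 'I_n]) [set x : 'rV[R]_n | ball (q pk.1 ord0 i) (r pk.2) (x ord0 i)].
  apply/seteqP; split => [x [_ qx] i _|x qx]; first exact: qx.
  by split => // i j; rewrite ord1; exact: qx.
rewrite preimage_bigcap; apply: fin_bigcap_measurable => // i _.
rewrite -[X in measurable X]setTI.
apply: (mf i measurableT (ball (q pk.1 ord0 i) (r pk.2))).
exact: measurable_ball.
Qed.

End measurable_rV.

Section cons_rV.
Context (R : realType) (n : nat).

Definition cons_rV (p : measurableTypeR R * borel_rV R n) : borel_rV R n.+1 :=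
  \row_j (if unlift ord0 j is Some k then p.2 ord0 k else p.1).

Definition uncons_rV (x : borel_rV R n.+1) : measurableTypeR R * borel_rV R n :=
  (x ord0 ord0, \row_j x ord0 (lift ord0 j)).

Lemma cons_rVK : cancel cons_rV uncons_rV.
Proof.
move=> [a x]; rewrite /uncons_rV/cons_rV mxE unlift_none; congr pair.
by apply/rowP => j; rewrite !mxE liftK.
Qed.

Lemma measurable_cons_rV : measurable_fun setT cons_rV.
Proof.
apply: measurable_fun_rV => i; case: (unliftP ord0 i) => [j ->|->].
  apply: (eq_measurable_fun
      (fun p : measurableTypeR R * borel_rV R n => p.2 ord0 j)).
    by move=> p _; rewrite mxE liftK.
  exact: measurableT_comp (measurable_coord_rV j) measurable_snd.
apply: (eq_measurable_fun (fun p : measurableTypeR R * borel_rV R n => p.1)).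
  by move=> p _; rewrite mxE unlift_none.
exact: measurable_fst.
Qed.

Lemma measurable_uncons_rV : measurable_fun setT uncons_rV.
Proof.
apply: measurable_fun_pair; first exact: measurable_coord_rV.
apply: measurable_fun_rV => i.
apply: (eq_measurable_fun (fun x : borel_rV R n.+1 => x ord0 (lift ord0 i))).
  by move=> p _; rewrite mxE.
exact: measurable_coord_rV.
Qed.

Variable mu : {sigma_finite_measure set (borel_rV R n) -> \bar R}.

Definition cons_measure : set (borel_rV R n.+1) -> \bar R :=
  pushforward (@lebesgue_measure R \x mu)%E cons_rV.

HB.instance Definition _ := Measure.copy cons_measure
  (measure_function_pushforward__canonical__measure_function_Measure
    (lebesgue_measure \x mu : {measure set _ -> \bar R})%E measurable_cons_rV).

Lemma cons_measureE A B : measurable A -> measurable B ->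
  cons_measure (uncons_rV @^-1` (A `*` B)) = (lebesgue_measure A * mu B)%E.
Proof.
move=> mA mB; rewrite /cons_measure/= /pushforward -comp_preimage.
rewrite (_ : _ \o _ = id); first exact: product_measure1E.
exact/funext/cons_rVK.
Qed.

Lemma cons_measure_sigma_finite : sigma_finite setT cons_measure.
Proof.
have /sigma_finiteP[F [TF ndF Foo]] := sigma_finiteT (@lebesgue_measure R).
have /sigma_finiteP[G [TG ndG Goo]] := sigma_finiteT mu.
exists (fun k => uncons_rV @^-1` (F k `*` G k)) => [|k].
  rewrite -preimage_bigcup; apply/esym; rewrite -subTset => z _.
  have : (\bigcup_n F n) (uncons_rV z).1 by rewrite -TF.
  have : (\bigcup_n G n) (uncons_rV z).2 by rewrite -TG.
  move=> [j _ Gj] [i _ Fi]; exists (maxn i j) => //; split.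
  - by move: Fi; exact/subsetPset/ndF/leq_maxl.
  - by move: Gj; exact/subsetPset/ndG/leq_maxr.
have [mF Fk] := Foo k; have [mG Gk] := Goo k; split; last first.
  by rewrite cons_measureE// lte_mul_pinfty// ge0_fin_numE.
by rewrite -[X in measurable X]setTI; apply: measurable_uncons_rV => //; exact: measurableX.
Qed.

HB.instance Definition _ := Measure_isSigmaFinite.Build _ _ _ cons_measure
  cons_measure_sigma_finite.

End cons_rV.

(* Lebesgue measure on R^n as the n-fold product of the Lebesgue measure on R;
   lebesgue_rV_box below gives its values on boxes. *)
Fixpoint lebesgue_rV (R : realType) (n : nat) :
    {sigma_finite_measure set (borel_rV R n) -> \bar R} :=
  if n is m.+1 return {sigma_finite_measure set (borel_rV R n) -> \bar R}
  then cons_measure (lebesgue_rV R m)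
  else \d_(0 : borel_rV R 0).

Lemma lebesgue_rV_box (R : realType) (n : nat) (A : 'I_n -> set (measurableTypeR R)) :
  (forall i, measurable (A i)) ->
  lebesgue_rV R n [set x | forall i, A i (x ord0 i)] =
  (\prod_(i < n) lebesgue_measure (A i))%E.
Proof.
elim: n A => [A _|n IH A mA].
  by rewrite big_ord0 /= diracE mem_set// => -[].
rewrite big_ord_recl -(IH (fun i => A (lift ord0 i)))//.
set B := [set x : borel_rV R n | forall i, A (lift ord0 i) (x ord0 i)].
have mB : measurable B.
  have -> : B = \bigcap_(i in [set: 'I_n])
      [set x : borel_rV R n | A (lift ord0 i) (x ord0 i)].
    by apply/seteqP; split => x /= h i; [move=> _|]; exact: h.
  apply: fin_bigcap_measurable => // i _.
  by rewrite -[X in measurable X]setTI; apply: measurable_coord_rV.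
rewrite -(cons_measureE (lebesgue_rV R n) (mA ord0) mB).
congr (cons_measure _ _); apply/seteqP; split => x /= h.
  by split => [|i]; rewrite ?mxE; exact: h.
move=> i; case: (unliftP ord0 i) => [j ->|->]; last exact: h.1.
by have := h.2 j; rewrite mxE.
Qed.

(* The library provides the type of L^p classes without algebraic structure; it
   is equipped here with its normed space structure. *)
Section Lspace_normedModType.
Context d (T : measurableType d) (R : realType).
Variables (mu : {measure set T -> \bar R}) (p : \bar R) (p1 : (1 <= p)%E).
Implicit Types (f g h : LfunType mu p1) (u v w : LspaceType mu p1).

Lemma ae_eq_Lnorm (f g : T -> R) :
  measurable_fun setT f -> measurable_fun setT g -> f = g %[ae mu] ->
  Lnorm mu p (EFin \o f) = Lnorm mu p (EFin \o g).
Proof.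
move=> mf mg fg; rewrite unlock; case: p p1 => [r _|_|//].
  congr (_ `^ _)%E; apply: ge0_ae_eq_integral => //.
  - apply: (measurableT_comp (measurable_poweR _)) => //.
    by apply: measurableT_comp => //; exact/measurable_EFinP.
  - apply: (measurableT_comp (measurable_poweR _)) => //.
    by apply: measurableT_comp => //; exact/measurable_EFinP.
  - by move=> x _; exact: poweR_ge0.
  - by move=> x _; exact: poweR_ge0.
  - exact: (ae_eq_comp (fun y => `|y%:E| `^ r)%E fg).
case: ifPn => // _; apply: ess_sup_inf.eq_ess_sup; apply: filterS fg => x /= fgx.
by rewrite fgx.
Qed.

Lemma Lfun_measurable f :
  measurable_fun setT (f : T -> measurableTypeR R).
Proof. exact: (measurable_funPT f). Qed.

Definition Lfun_mfun f : {mfun T >-> measurableTypeR R} :=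
  HB.pack_for {mfun T >-> measurableTypeR R} (f : T -> measurableTypeR R)
    (isMeasurableFun.Build _ _ _ _ (f : T -> measurableTypeR R)
      (Lfun_measurable f)).

Definition Lclass_mfun f : {mfun_ mu, T >-> measurableTypeR R} :=
  (\pi_({mfun_ mu, T >-> measurableTypeR R}) (Lfun_mfun f))%qT.

Lemma Lclass_mfunE f : (Lclass_mfun f : T -> R) = f %[ae mu].
Proof.
by have /eqmodP/asboolP := reprK (Lclass_mfun f).
Qed.

Lemma Lclass_finite f : finite_norm mu p (Lclass_mfun f).
Proof.
rewrite /finite_norm (ae_eq_Lnorm _ _ (Lclass_mfunE f))//.
  exact: Lfunction_finite.
exact: (measurable_funPT (repr (Lclass_mfun f))).
Qed.

(* The class of f in L^p. *)
Definition Lclass f : LspaceType mu p1 :=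
  HB.pack_for (LspaceType mu p1) (Lclass_mfun f)
    (isFinLebesgue.Build _ _ _ _ _ p1 (Lclass_mfun f) (Lclass_finite f)).

Lemma Lspace_Lfun u : (u : T -> R) \in Lfun mu p.
Proof.
apply/andP; split; apply/mem_set; last exact: (@Lebesgue_finite _ _ _ _ _ p1 u).
exact: (measurable_funPT (repr (u : {mfun_ mu, T >-> measurableTypeR R}))).
Qed.

Definition Lrepr u : LfunType mu p1 := Lfun_Sub p1 (Lspace_Lfun u).


Lemma Lspace_inj u v :
  u = v :> {mfun_ mu, T >-> measurableTypeR R} -> u = v.
Proof.
case: u v => [u [[uP]]] [v [[vP]]] /= uv; rewrite {}uv in uP *.
by rewrite (Prop_irrelevance uP vP).
Qed.

Lemma Lclass_eqP f g : Lclass f = Lclass g <-> f = g %[ae mu].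
Proof.
split=> [fg|fg].
  apply: ae_eq_trans (Lclass_mfunE g).
  apply: ae_eq_trans (ae_eq_sym (Lclass_mfunE f)) _.
  by rewrite -[Lclass_mfun f]/(LebesgueSpace.sort (Lclass f)) fg; exact: ae_eq_refl.
by apply/Lspace_inj/eqmodP/asboolP.
Qed.

Lemma LclassK f : Lrepr (Lclass f) = f %[ae mu].
Proof. exact: Lclass_mfunE. Qed.

Lemma LreprK : cancel Lrepr Lclass.
Proof.
move=> u; apply: Lspace_inj; rewrite /= -[RHS]reprK.
by apply/eqmodP/asboolP; exact: ae_eq_refl.
Qed.

HB.instance Definition _ := gen_eqMixin (LspaceType mu p1).
HB.instance Definition _ := gen_choiceMixin (LspaceType mu p1).

Definition Lspace_zero : LspaceType mu p1 := Lclass 0.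
Definition Lspace_opp u := Lclass (- Lrepr u).
Definition Lspace_add u v := Lclass (Lrepr u + Lrepr v).
Definition Lspace_scale (a : R) u := Lclass (a *: Lrepr u).
Definition Lspace_norm u : R := fine (Lnorm mu p (EFin \o (u : T -> R))).

Lemma Lclass_opp f : Lspace_opp (Lclass f) = Lclass (- f).
Proof.
apply/Lclass_eqP; have := LclassK f.
by apply: filterS => x /[apply] /= fx; rewrite !fctE/= fx.
Qed.

Lemma Lclass_add f g : Lspace_add (Lclass f) (Lclass g) = Lclass (f + g).
Proof.
apply/Lclass_eqP; have := LclassK g; have := LclassK f.
apply: filterS2 => x fx gx xT.
change (Lrepr (Lclass f) x + Lrepr (Lclass g) x = f x + g x).
by rewrite fx// gx.
Qed.

Lemma Lclass_scale a f : Lspace_scale a (Lclass f) = Lclass (a *: f).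
Proof.
apply/Lclass_eqP; have := LclassK f.
by apply: filterS => x /[apply] /= fx; rewrite !fctE/= fx.
Qed.

Lemma Lclass_norm f : (Lspace_norm (Lclass f))%:E = Lnorm mu p (EFin \o f).
Proof.
rewrite -finite_norm_fine; congr EFin; congr fine.
apply: ae_eq_Lnorm (LclassK f) => //; exact: (measurable_funPT (repr (Lclass_mfun f))).
Qed.

Lemma Lspace_ind (P : LspaceType mu p1 -> Prop) :
  (forall f, P (Lclass f)) -> forall u, P u.
Proof. by move=> Pf u; rewrite -[u]LreprK. Qed.

Let addA : associative Lspace_add.
Proof.
elim/Lspace_ind => f; elim/Lspace_ind => g; elim/Lspace_ind => h.
by rewrite !Lclass_add addrA.
Qed.

Let addC : commutative Lspace_add.
Proof.
by elim/Lspace_ind => f; elim/Lspace_ind => g; rewrite !Lclass_add addrC.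
Qed.

Let add0 : left_id Lspace_zero Lspace_add.
Proof. by elim/Lspace_ind => f; rewrite Lclass_add add0r. Qed.

Let addN : left_inverse Lspace_zero Lspace_opp Lspace_add.
Proof. by elim/Lspace_ind => f; rewrite Lclass_opp Lclass_add addNr. Qed.

HB.instance Definition _ :=
  GRing.isZmodule.Build (LspaceType mu p1) addA addC add0 addN.

Lemma LclassD f g : Lclass f + Lclass g = Lclass (f + g).
Proof. exact: Lclass_add. Qed.

Let scaleA a b u :
  Lspace_scale a (Lspace_scale b u) = Lspace_scale (a * b) u.
Proof. by elim/Lspace_ind : u => f; rewrite !Lclass_scale scalerA. Qed.

Let scale1 : left_id 1 Lspace_scale.
Proof. by elim/Lspace_ind => f; rewrite Lclass_scale scale1r. Qed.

Let scaleDr : right_distributive Lspace_scale +%R.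
Proof.
move=> a; elim/Lspace_ind => f; elim/Lspace_ind => g.
by rewrite !(LclassD, Lclass_scale) scalerDr.
Qed.

Let scaleDl u : {morph Lspace_scale^~ u : a b / a + b}.
Proof.
by elim/Lspace_ind : u => f a b; rewrite !Lclass_scale LclassD -scalerDl.
Qed.

HB.instance Definition _ := GRing.Zmodule_isLmodule.Build R (LspaceType mu p1)
  scaleA scale1 scaleDr scaleDl.

Lemma LclassZ a f : a *: Lclass f = Lclass (a *: f).
Proof. exact: Lclass_scale. Qed.

Let normD u v : Lspace_norm (u + v) <= Lspace_norm u + Lspace_norm v.
Proof.
rewrite -[u]LreprK -[v]LreprK; move: (Lrepr u) (Lrepr v) => f g.
rewrite -lee_fin EFinD LclassD !Lclass_norm.
by rewrite eminkowski.
Qed.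

Let normZ a u : Lspace_norm (a *: u) = `|a| * Lspace_norm u.
Proof.
elim/Lspace_ind : u => f.
apply: EFin_inj; rewrite EFinM LclassZ !Lclass_norm.
exact: LnormZ.
Qed.

Let norm0_eq0 u : Lspace_norm u = 0 -> u = 0.
Proof.
rewrite -[u]LreprK; move: (Lrepr u) => f nf.
have f0 : Lnorm mu p (EFin \o f) = 0%E by rewrite -Lclass_norm nf.
by apply/Lclass_eqP; apply: (@fine_Lnormr_eq0 _ _ _ mu _ p1); rewrite f0.
Qed.

HB.instance Definition _ := Lmodule_isNormed.Build R (LspaceType mu p1)
  normD normZ norm0_eq0.

End Lspace_normedModType.

Lemma Lspace_normE d (T : measurableType d) (R : realType)
    (mu : {measure set T -> \bar R}) (p : \bar R) (p1 : (1 <= p)%E)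
    (u : LspaceType mu p1) :
  `|u| = fine (Lnorm mu p (EFin \o (u : T -> R))).
Proof. by []. Qed.

(* Lebesgue measure on Omega, as a measure on R^n vanishing outside Omega: an
   a.e. class for it is an a.e. class of functions on Omega. *)
Definition lebesgue_on (R : realType) (n : nat) (Omega : set 'rV[R]_n)
    (oO : open Omega) : {measure set (borel_rV R n) -> \bar R} :=
  mrestr (lebesgue_rV R n) (open_measurable_rV oO).

Notation L2 oO := (LspaceType2 (lebesgue_on oO)).

Definition L2_constants (R : realType) (n : nat) (Omega : set 'rV[R]_n)
    (oO : open Omega) : set (L2 oO) :=
  [set u | exists c : R, (u : 'rV[R]_n -> R) = cst c %[ae lebesgue_on oO]].

Section functionals.
Context (R : realType) (V : normedModType R).
Implicit Types (F : V -> \bar R) (u v : V).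
Local Open Scope ereal_scope.

Definition weak_cvg (u_ : nat -> V) u : Prop :=
  forall f : {linear V -> R^o}, continuous f -> f (u_ k) @[k --> \oo] --> f u.

Definition mosco_cvg (F_ : nat -> V -> \bar R) F : Prop :=
  (forall (u_ : nat -> V) u, weak_cvg u_ u -> F u <= limn_einf (fun k => F_ k (u_ k))) /\
  (forall u, exists2 u_ : nat -> V, u_ @ \oo --> u &
     limn_esup (fun k => F_ k (u_ k)) <= F u).

(* The Mosco limit of (F_ a) as the parameter a > 0 tends to alpha in
   [0, +oo]. *)
Definition mosco_cvg_at (F_ : R -> V -> \bar R) (alpha : \bar R) F : Prop :=
  forall a : nat -> R, (forall k, (0 < a k)%R) ->
    (a k)%:E @[k --> \oo] --> alpha -> mosco_cvg (fun k => F_ (a k)) F.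

Definition econvex F : Prop :=
  forall (t : R) u v, (0 <= t <= 1)%R ->
    F (t *: u + (1 - t) *: v)%R <= t%:E * F u + (1 - t)%:E * F v.

Definition scale_functional F (a : R) : V -> \bar R := fun u => a%:E * F u.

Definition set_indicator (C : set V) : V -> \bar R :=
  fun u => if u \in C then 0 else +oo.

(* Only used for alpha in [0, +oo]; the value at -oo is irrelevant. *)
Definition scale_functional_bar F (C : set V) (alpha : \bar R) : V -> \bar R :=
  match alpha with
  | a%:E => if a == 0%R then fun=> 0 else scale_functional F a
  | _ => set_indicator C
  end.

End functionals.

(* Main.v *)
Require Import Defs.
From HB Require Import structures.
From mathcomp Require Import all_boot all_order all_algebra.
From mathcomp Require Import all_classical all_reals all_analysis.
From mathcomp Require Import lra.

(** The result holds for any convex, lower semicontinuous [F >= 0] with dense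
domain on a real normed space, the constants entering only as the zero set
of [F]; see [mosco_cvg_at_scale].

Liminf inequality.  The one deep ingredient is that [F] is sequentially
weakly lower semicontinuous ([weak_lsc]): a sublevel set of [F] is convex and
stays at positive distance from any point where [F] is larger, so a continuous
linear functional separates the two ([convex_separation]).  If
[u_k] tends weakly to [u], [0 < b < alpha] and [c < F u], then eventually
[a_k > b] and [F u_k > c], whence [b c <= liminf a_k F(u_k)].  Letting [c] tend
to [F u] and [b] to [alpha] gives the bound: [alpha F(u)] for finite [alpha];
for infinite [alpha] the bound [b F(u)] with [b] arbitrary, which is infinite
unless [F u = 0].

Limsup inequality.  For [alpha > 0] constant sequences are recovery sequences.
For [alpha = 0] the point [u] may lie outside the domain; one takes for [u_k]
a near-minimiser of [v |-> |u - v| + a_k F(v)].  Testing against points of the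
domain close to [u] shows that these minima tend to [0], so both terms do
([recovery_at_0]).

The separation theorem rests on the analytic Hahn-Banach theorem
([hahn_banach_dominated]), obtained by Zorn's lemma in the form: every
sublinear functional dominates a minimal one, and minimal ones are linear.
Both the linearity of minimal functionals and the separation come from the
same construction, the shift of a sublinear functional along a convex set
([sublinear_shift]). *)

Set Implicit Arguments.
Unset Strict Implicit.
Unset Printing Implicit Defensive.
Import Order.TTheory GRing.Theory Num.Theory numFieldNormedType.Exports.

Local Open Scope classical_set_scope.
Local Open Scope ring_scope.

(** * Sublinear functionals and the Hahn-Banach theorem *)

Section sublinear.
Context (R : realType) (V : lmodType R).
Implicit Types (p q : V -> R) (K : set V).

(** Subadditivity and positive homogeneity in a single inequality, which is
stable under infima; homogeneity as an equality is [sublinearZ]. *)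
Definition sublinear q : Prop := forall a b x y, 0 <= a -> 0 <= b ->
  q (a *: x + b *: y) <= a * q x + b * q y.

Definition convex_subset K : Prop := forall t x y, 0 <= t <= 1 ->
  K x -> K y -> K (t *: x + (1 - t) *: y).

Lemma sublinear0 q : sublinear q -> q 0 = 0.
Proof.
move=> sq; apply/le_anti/andP; split.
  by have := sq 0 0 0 0 (lexx _) (lexx _); rewrite !scale0r !mul0r !addr0.
have := sq 1 1 0 0 ler01 ler01.
by rewrite !scale1r !mul1r addr0 lerDr.
Qed.

Lemma sublinearD q x y : sublinear q -> q (x + y) <= q x + q y.
Proof. by move=> /(_ 1 1 x y ler01 ler01); rewrite !scale1r !mul1r. Qed.

Lemma sublinearZ_le q t x : sublinear q -> 0 <= t -> q (t *: x) <= t * q x.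
Proof.
by move=> /(_ t 0 x 0 _ (lexx _)) /[apply]; rewrite scale0r mul0r !addr0.
Qed.

Lemma sublinearZ q t x : sublinear q -> 0 <= t -> q (t *: x) = t * q x.
Proof.
move=> sq; rewrite le0r => /predU1P[->|t0].
  by rewrite scale0r mul0r sublinear0.
apply/le_anti; rewrite sublinearZ_le ?(ltW t0)//=.
have := sublinearZ_le (t *: x) sq (ltW (_ : 0 < t^-1)).
rewrite invr_gt0 => /(_ t0); rewrite scalerA mulVf ?gt_eqF// scale1r.
by rewrite mulrC ler_pdivlMr// mulrC.
Qed.

Lemma sublinear_geN q x : sublinear q -> - q (- x) <= q x.
Proof.
move=> sq; have := sublinearD x (- x) sq; rewrite subrr sublinear0//.
by rewrite -lerBlDr sub0r.
Qed.

Lemma le_mul_inf (A : set R) (a c z : R) : A !=set0 -> 0 <= a ->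
  (forall x, A x -> z <= a * x + c) -> z <= a * inf A + c.
Proof.
move=> A0; rewrite le0r => /predU1P[->|a0] zA.
  by have [x /zA] := A0; rewrite !mul0r.
rewrite -lerBlDr mulrC -ler_pdivrMr//; apply: lb_le_inf => // x /zA.
by rewrite -lerBlDr mulrC -ler_pdivrMr.
Qed.

(** Infima in [x] and [y] are approached along different members [i] and [j] of
the family; the third member [k] is what bounds the infimum at the combined
point.  This covers infima of chains as well as the infimum over
translates in [sublinear_shift]. *)
Lemma sublinear_inf (I : Type) (D : set I) (g : I -> V -> R) :
  D !=set0 -> (forall x, has_lbound [set g i x | i in D]) ->
  (forall a b x y i j, 0 <= a -> 0 <= b -> D i -> D j ->
    exists2 k, D k & g k (a *: x + b *: y) <= a * g i x + b * g j y) ->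
  sublinear (fun x => inf [set g i x | i in D]).
Proof.
move=> [i0 Di0] lbg dirg a b x y a0 b0.
have neg z : [set g i z | i in D] !=set0 by exists (g i0 z), i0.
apply: le_mul_inf => // _ [i Di <-]; rewrite [leRHS]addrC.
apply: le_mul_inf => // _ [j Dj <-]; rewrite [leRHS]addrC.
have [k Dk] := dirg a b x y i j a0 b0 Di Dj.
by apply: le_trans; apply: ge_inf => //; exists k.
Qed.

(** The functional [q'] is the infimum of [q (x + t y) - t d] over [t >= 0] and
[y] in [K]; it is finite because [q (x + t y) >= t q y - q (- x)] and
[q y >= d].  Taking [t = 0] gives [q' <= q], and taking [x = - y], [t = 1]
gives [q' (- y) <= - d], so that any linear functional below [q'] is at least
[d] on [K]. *)
Lemma sublinear_shift q K (d : R) : sublinear q -> K !=set0 ->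
  convex_subset K -> (forall y, K y -> d <= q y) ->
  exists2 q', sublinear q' & forall t x y, 0 <= t -> K y ->
    q' x <= q (x + t *: y) - t * d.
Proof.
move=> sq [y0 Ky0] cK dq.
pose D := [set ty : R * V | 0 <= ty.1 /\ K ty.2].
pose g (ty : R * V) x := q (x + ty.1 *: ty.2) - ty.1 * d.
have lbg x : has_lbound [set g i x | i in D].
  exists (- q (- x)) => _ [[t y] [/= t0 Ky] <-]; rewrite /g/=.
  have := sublinearD (x + t *: y) (- x) sq.
  rewrite addrAC subrr add0r sublinearZ//.
  have := ler_wpM2l t0 (dq y Ky); lra.
exists (fun x => inf [set g i x | i in D]); last first.
  by move=> t x y t0 Ky; apply: ge_inf => //; exists (t, y).
apply: sublinear_inf => //; first by exists (0, y0); split => /=.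
move=> a b x y [s u] [t v] a0 b0 [/= s0 Ku] [/= t0 Kv].
have as0 : 0 <= a * s by exact: mulr_ge0.
have bt0 : 0 <= b * t by exact: mulr_ge0.
(* The two shifts s u and t v combine into a single one, along the convex
   combination of u and v with weights proportional to a s and b t. *)
have [w Kw wE] : exists2 w, K w &
    (a * s + b * t) *: w = (a * s) *: u + (b * t) *: v.
  have [st0|st0] := eqVneq (a * s + b * t) 0.
    exists u => //; move: st0 => /eqP; rewrite paddr_eq0// => /andP[/eqP-> /eqP->].
    by rewrite add0r !scale0r addr0.
  exists ((a * s / (a * s + b * t)) *: u + (1 - a * s / (a * s + b * t)) *: v).
    apply: cK => //; rewrite divr_ge0 ?addr_ge0//=.
    by rewrite ler_pdivrMr ?mul1r ?lerDl// lt0r st0 addr_ge0.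
  rewrite scalerDr !scalerA mulrBr mulrCA divff// !mulr1.
  by rewrite (addrC (a * s)) addrK.
exists (a * s + b * t, w); first by split => //=; rewrite addr_ge0.
rewrite /g/= wE.
have -> : a *: x + b *: y + ((a * s) *: u + (b * t) *: v) =
    a *: (x + s *: u) + b *: (y + t *: v).
  by rewrite addrACA !scalerDr !scalerA.
have := sq a b (x + s *: u) (y + t *: v) a0 b0; lra.
Qed.

(** Zorn's lemma applies because a chain of sublinear functionals below [p] is
bounded below pointwise by [- p (- x)], so its infimum is finite. *)
Lemma sublinear_minimal p : sublinear p -> exists q,
  [/\ sublinear q, forall x, q x <= p x &
    forall q', sublinear q' -> (forall x, q' x <= q x) -> forall x, q x <= q' x].
Proof.
move=> sp.
pose T := {q | sublinear q /\ forall x, q x <= p x}.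
pose ge_fun (q1 q2 : T) := `[< forall x, sval q2 x <= sval q1 x >].
have pP : sublinear p /\ forall x, p x <= p x by [].
have [||A totA|[q [sq qp]] qmin] := @ZL_preorder T (exist _ p pP) ge_fun.
- by move=> q; apply/asboolP.
- move=> q1 q2 q3 /asboolP q21 /asboolP q32; apply/asboolP => x.
  exact: le_trans (q32 x) (q21 x).
- have [[q0 Aq0]|A0] := pselect (A !=set0); last first.
    by exists (exist _ p pP) => q Aq; case: A0; exists q.
  have lbA x : has_lbound [set sval q x | q in A].
    exists (- p (- x)) => _ [[q [sq qp]] _ <-] /=.
    by apply: le_trans (sublinear_geN _ sq); rewrite lerN2.
  pose m x := inf [set sval q x | q in A].
  have mle (r : T) x : A r -> m x <= sval r x.
    by move=> Ar; apply: ge_inf => //; exists r.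
  have sm : sublinear m.
    apply: sublinear_inf => // [|a b x y q1 q2 a0 b0 Aq1 Aq2]; first by exists q0.
    have [/asboolP le21|/asboolP le12] := totA _ _ Aq1 Aq2.
    + exists q2 => //; apply: le_trans ((svalP q2).1 a b x y a0 b0) _.
      by rewrite lerD2r ler_wpM2l.
    + exists q1 => //; apply: le_trans ((svalP q1).1 a b x y a0 b0) _.
      by rewrite lerD2l ler_wpM2l.
  have mp x : m x <= p x by exact: le_trans (mle _ _ Aq0) ((svalP q0).2 x).
  by exists (exist _ m (conj sm mp)) => q Aq; apply/asboolP => x /=; exact: mle.
exists q; split=> // q' sq' q'q.
have q'p x : q' x <= p x by exact: le_trans (q'q x) (qp x).
by have /asboolP := qmin (exist _ q' (conj sq' q'p)) (asboolT q'q).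
Qed.

(** A minimal sublinear [q] below [p] is linear: shifting [q] along [{y}] with
[d = q y] gives [q' <= q] with [q' x <= q (x + y) - q y], and minimality forces
[q x <= q (x + y) - q y], which is additivity. *)
Lemma hahn_banach_dominated p : sublinear p ->
  exists f : {linear V -> R^o}, forall x, f x <= p x.
Proof.
move=> /sublinear_minimal[q [sq qp qmin]].
have qD x y : q (x + y) = q x + q y.
  apply/le_anti; rewrite sublinearD//=.
  have [|||q' sq' q'q] := @sublinear_shift q [set y] (q y) sq.
  - by exists y.
  - by move=> t u v _ -> ->; rewrite -scalerDl addrC subrK scale1r.
  - by move=> _ ->.
  have q'le z : q' z <= q z.
    by have := q'q 0 z y (lexx _) erefl; rewrite scale0r addr0 mul0r subr0.
  rewrite -lerBrDr; apply: le_trans (qmin q' sq' q'le x) _.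
  by have := q'q 1 x y ler01 erefl; rewrite scale1r mul1r.
have qN x : q (- x) = - q x.
  by apply/eqP; rewrite -addr_eq0 -qD addNr sublinear0.
have qlin : linear (q : V -> R^o).
  move=> a x y; rewrite qD; congr (_ + _).
  have [a0|/ltW a0] := leP 0 a; first by rewrite sublinearZ.
  by rewrite -[a in LHS]opprK scaleNr qN sublinearZ ?oppr_ge0// mulNr opprK.
by exists (HB.pack_for {linear V -> R^o} (q : V -> R^o)
  (GRing.isLinear.Build R V R^o _ _ qlin)).
Qed.

End sublinear.

(** * Separation of a point from a convex set *)

Section separation.
Context (R : realType) (V : normedModType R).

Lemma sublinear_norm : sublinear (fun x : V => `|x|).
Proof.
move=> a b x y a0 b0; apply: le_trans (ler_normD _ _) _.
by rewrite !normrZ !ger0_norm.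
Qed.

(** The norm is at least [d] on the convex set [u - K]; a linear functional
below the shift of the norm along [u - K] is bounded by the norm, hence
continuous, and at least [d] on [u - K]. *)
Lemma convex_separation (K : set V) (u : V) (d : R) :
  K !=set0 -> convex_subset K -> (forall y, K y -> d <= `|u - y|) ->
  exists2 f : {linear V -> R^o}, continuous f & forall y, K y -> f y <= f u - d.
Proof.
move=> [y0 Ky0] cK du.
have [|||q sq qle] :=
    @sublinear_shift _ _ _ [set u - y | y in K] d sublinear_norm.
- by exists (u - y0), y0.
- move=> t _ _ t01 [x Kx <-] [y Ky <-].
  exists (t *: x + (1 - t) *: y); first exact: cK.
  by rewrite !scalerBr addrACA -scalerDl [t + _]addrC subrK scale1r opprD.
- by move=> _ [y Ky <-]; exact: du.
have [f fq] := hahn_banach_dominated sq.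
have f_norm x : f x <= `|x|.
  apply: le_trans (fq x) _.
  have := qle 0 x (u - y0) (lexx _) (ex_intro2 _ _ y0 Ky0 erefl).
  by rewrite scale0r addr0 mul0r subr0.
exists f => [|y Ky].
  apply: bounded_linear_continuous; apply/linear_boundedP.
  near=> r => x; apply: (@le_trans _ _ `|x|).
    rewrite ler_norml f_norm andbT lerNl -linearN.
    by apply: le_trans (f_norm _) _; rewrite normrN.
  by rewrite ler_peMl.
have := qle 1 (y - u) (u - y) ler01 (ex_intro2 _ _ y Ky erefl).
rewrite scale1r mul1r addrA subrK subrr normr0 sub0r => /(le_trans (fq _)).
by rewrite linearB/= lerBlDl addrC.
Unshelve. all: by end_near. Qed.

End separation.

Local Open Scope ereal_scope.

(** * Extended real limits inferior and superior *)

Section ereal_limits.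
Context (R : realType).
Implicit Types (x y : \bar R) (u : (\bar R)^nat).

Lemma lee_of_lt_fin x y : (forall c : R, c%:E < x -> c%:E <= y) -> x <= y.
Proof.
move=> xy; rewrite leNgt; apply/negP => yx.
have [c yc cx] : exists2 c : R, y < c%:E & c%:E < x.
  case: x y yx {xy} => [r| |] [s| |] //=.
  - rewrite lte_fin => sr; exists ((s + r) / 2)%R; rewrite lte_fin.
      exact: (midf_lt sr).1.
    exact: (midf_lt sr).2.
  - by move=> _; exists (r - 1)%R; rewrite ?ltNyr// lte_fin ltrBlDr ltrDl.
  - by move=> _; exists (s + 1)%R; rewrite ?ltry// lte_fin ltrDl.
  - by move=> _; exists 0%R; rewrite ?ltNyr ?ltry.
by have := xy c cx; rewrite leNgt yc.
Qed.

Lemma le_limn_einf u x :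
  (\forall k \near \oo, x <= u k) -> x <= limn_einf u.
Proof.
move=> [N _ xu]; rewrite limn_einf_lim; apply: lime_ge; first exact: is_cvg_einfs.
exists N => // n /= Nn; apply: le_ereal_inf_tmp => _ [k /= nk <-].
by apply: xu => /=; exact: leq_trans nk.
Qed.

Lemma limn_esup_le u x :
  (\forall k \near \oo, u k <= x) -> limn_esup u <= x.
Proof.
move=> [N _ ux]; rewrite limn_esup_lim; apply: lime_le; first exact: is_cvg_esups.
exists N => // n /= Nn; apply: ge_ereal_sup => _ [k /= nk <-].
by apply: ux => /=; exact: leq_trans nk.
Qed.

End ereal_limits.

(** * Weak lower semicontinuity and Mosco limits of scaled functionals *)

Section mosco.
Context (R : realType) (V : normedModType R) (F : V -> \bar R).
Hypotheses (F_ge0 : forall u, 0 <= F u) (F_convex : econvex F)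
  (F_lsc : lower_semicontinuous F) (F_dom : dense [set u | F u < +oo]).

Lemma sublevel_convex (c : R) : convex_subset [set v | F v <= c%:E].
Proof.
move=> t x y t01 /= Fx Fy; have /andP[t0 t1] := t01.
apply: le_trans (F_convex x y t01) _.
have -> : c%:E = t%:E * c%:E + (1 - t)%:E * c%:E.
  by rewrite -!EFinM -EFinD -mulrDl addrC subrK mul1r.
by apply: leeD; apply: lee_wpmul2l; rewrite ?lee_fin ?subr_ge0.
Qed.

(** By lower semicontinuity a ball around [u] avoids the convex set [F <= c];
the separating functional [f] is bounded away from [f u] on that set while
[f (u_k)] tends to [f u], so [u_k] eventually leaves it. *)
Lemma weak_lsc (u_ : nat -> V) (u : V) (c : R) :
  weak_cvg u_ u -> c%:E < F u -> \forall k \near \oo, c%:E < F (u_ k).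
Proof.
move=> u_u /F_lsc[W /nbhs_ballP[e /= e0 eW] Wc].
have [[y0 Fy0]|empty] := pselect ([set v | F v <= c%:E] !=set0); last first.
  by apply: nearW => k; rewrite ltNge; apply/negP => Fk; apply: empty; exists (u_ k).
have [||f fcont fsep] :=
    @convex_separation _ _ _ u e _ (@sublevel_convex c).
- by exists y0.
- move=> y /= Fy; rewrite leNgt; apply/negP => uy.
  have : c%:E < F y by apply/Wc/eW; rewrite -ball_normE.
  by rewrite ltNge Fy.
have : \forall k \near \oo, (f u - e < f (u_ k))%R.
  by apply: cvgr_gt (u_u f fcont) _ _; rewrite ltrBlDr ltrDl.
apply: filterS => k; rewrite !ltNge => /negP h; apply/negP => Fk.
by apply: h; exact: fsep.
Qed.

Section fixed_parameters.
Context (a : nat -> R) (alpha : \bar R).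
Hypotheses (a_gt0 : forall k, (0 < a k)%R)
  (a_cvg : (a k)%:E @[k --> \oo] --> alpha).

Lemma limn_einf_scale_ge0 (u_ : nat -> V) :
  0 <= limn_einf (fun k => scale_functional F (a k) (u_ k)).
Proof.
by apply/le_limn_einf/nearW => k; apply: mule_ge0; [rewrite lee_fin ltW|].
Qed.

Lemma limn_einf_scale_lower (u_ : nat -> V) (u : V) (b : R) :
  weak_cvg u_ u -> (0 < b)%R -> b%:E < alpha ->
  b%:E * F u <= limn_einf (fun k => scale_functional F (a k) (u_ k)).
Proof.
move=> u_u b0 ba; rewrite -lee_pdivlMl//; apply: lee_of_lt_fin => c cFu.
rewrite lee_pdivlMl//; apply: le_limn_einf.
have ak : \forall k \near \oo, b%:E < (a k)%:E.
  apply: (a_cvg (_ : nbhs alpha [set x | b%:E < x])).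
  by apply: open_nbhs_nbhs; split => //; exact: open_ereal_gt_ereal.
near=> k; apply: (@le_trans _ _ (b%:E * F (u_ k))).
  apply: lee_wpmul2l; first by rewrite lee_fin ltW.
  by apply/ltW; near: k; exact: (weak_lsc u_u cFu).
by apply: lee_wpmul2r => //; apply/ltW; near: k.
Unshelve. all: by end_near. Qed.

(** The liminf inequality, from [limn_einf_scale_lower] by letting [b] increase
to [alpha]: along [b = s alpha], [s < 1], when [alpha] is finite; otherwise [b]
is arbitrarily large. *)
Lemma scale_bar_le_limn_einf (u_ : nat -> V) (u : V) : 0 <= alpha ->
  weak_cvg u_ u -> scale_functional_bar F [set v | F v = 0] alpha u <=
    limn_einf (fun k => scale_functional F (a k) (u_ k)).
Proof.
move=> alpha0 u_u; have low b := @limn_einf_scale_lower u_ u b u_u.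
have L0 := limn_einf_scale_ge0 u_.
move: (limn_einf _) L0 low => L L0.
case: alpha alpha0 => [r| |//] /=.
  rewrite lee_fin le0r => /predU1P[->|r0] low; first by rewrite eqxx.
  rewrite gt_eqF//; apply/lee_mul01Pr.
    by apply: mule_ge0; rewrite // lee_fin ltW.
  move=> s /andP[s0 s1]; rewrite /scale_functional muleA -EFinM; apply: low.
    exact: mulr_gt0.
  by rewrite lte_fin gtr_pMl.
move=> _ low; rewrite /set_indicator; case: ifPn => // /negP Fu_neq0.
have Fu_gt0 : 0 < F u.
  by rewrite lt0e F_ge0 andbT; apply/eqP => Fu0; apply: Fu_neq0; rewrite inE.
rewrite leye_eq; apply/eqP/eqyP => A A0.
case E : (F u) Fu_gt0 => [s| |//] Fu_gt0; last first.
  have := low 1%R ltr01 (ltry _).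
  by rewrite E mul1e => /(le_trans _); apply; exact: leey.
have := low (A / s)%R; rewrite E -EFinM divfK ?gt_eqF//; apply.
  exact: divr_gt0.
exact: ltry.
Qed.

Lemma limn_esup_scale_cst (u : V) : 0 < alpha ->
  limn_esup (fun k => scale_functional F (a k) u) <=
    scale_functional_bar F [set v | F v = 0] alpha u.
Proof.
case: alpha a_cvg => [r| |//] a_r /=; last first.
  move=> _; rewrite /set_indicator; case: ifPn => [|_]; last exact: leey.
  rewrite inE /= => Fu0; apply/limn_esup_le/nearW => k.
  by rewrite /scale_functional Fu0 mule0.
rewrite lte_fin => r0; rewrite gt_eqF//.
case E : (F u) (F_ge0 u) => [s| |//] _; last first.
  by rewrite /scale_functional E gt0_muley ?lte_fin ?leey.
have sr : scale_functional F (a k) u @[k --> \oo] --> scale_functional F r u.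
  by rewrite /scale_functional E; apply: cvgeZr.
by have [_ ->] := cvg_limn_einf_sup sr.
Qed.

(** The recovery sequence consists of near-minimisers [u_k] of
[phi_k v = |u - v| + a_k F(v)], up to the error [1 / (k + 1)].  For [w] in the
domain, [phi_k w] tends to [|u - w|], which density makes as small as
desired. *)
Lemma recovery_at_0 (u : V) : alpha = 0 -> exists2 u_ : nat -> V,
  u_ @ \oo --> u & limn_esup (fun k => scale_functional F (a k) (u_ k)) <= 0.
Proof.
move=> alpha0.
pose phi k v := `|u - v|%:E + scale_functional F (a k) v.
have aF_ge0 k v : 0 <= scale_functional F (a k) v.
  by apply: mule_ge0; [rewrite lee_fin ltW|].
have phi_ge0 k v : 0 <= phi k v by apply: adde_ge0.
have close (e : R) : (0 < e)%R -> exists w, (`|u - w| < e)%R /\ F w < +oo.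
  move=> e0; have [w [uw Fw]] := F_dom (ex_intro _ u (ballxx u e0)) (ball_open u e).
  by exists w; split=> //; have : ball u e w := uw; rewrite -ball_normE.
have near_min k : exists v, forall w, phi k v <= phi k w + k.+1%:R^-1%:E.
  have [w0 [_ Fw0]] := close 1%R ltr01.
  have [||_ [v _ <-] phiv] := @lb_ereal_inf_adherent _ (range (phi k)) k.+1%:R^-1.
  - by rewrite invr_gt0.
  - rewrite ge0_fin_numE; last first.
      by apply: le_ereal_inf_tmp => _ [v _ <-]; exact: phi_ge0.
    apply: (@le_lt_trans _ _ (phi k w0)); first by apply: ereal_inf_lbound; exists w0.
    case E : (F w0) Fw0 (F_ge0 w0) => [s| |]// _ _.
    by rewrite /phi /scale_functional E -EFinM -EFinD ltry.
  exists v => w; apply: le_trans (ltW phiv) _.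
  by rewrite leeD2r//; apply: ereal_inf_lbound; exists w.
have [u_ u_min] := choice near_min.
have phi_small (e : R) : (0 < e)%R -> \forall k \near \oo, phi k (u_ k) <= e%:E.
  move=> e0; have e3 : (0 < e / 3)%R by rewrite divr_gt0.
  have [w [uw Fw]] := close _ e3.
  case E : (F w) Fw (F_ge0 w) => [s| |]// _ s0; rewrite lee_fin in s0.
  have s1 : (0 < s + 1)%R by rewrite ltr_wpDl.
  (* s + 1 rather than s, since F w = s may vanish. *)
  have a_small : \forall k \near \oo, (a k)%:E < (e / 3 / (s + 1))%:E.
    apply: (a_cvg (_ : nbhs alpha [set x | x < (e / 3 / (s + 1))%:E])).
    apply: open_nbhs_nbhs; split; first exact: open_ereal_lt_ereal.
    by rewrite /= alpha0 lte_fin divr_gt0.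
  near=> k; apply: le_trans (u_min k w) _.
  rewrite /phi /scale_functional E -EFinM -!EFinD lee_fin.
  have -> : e = (e / 3 + e / 3 + e / 3)%R by lra.
  apply: lerD; first apply: lerD; first exact: ltW.
    apply: (@le_trans _ _ (a k * (s + 1))%R).
      by rewrite ler_pM2l// lerDl.
    rewrite -ler_pdivlMr//; apply/ltW; rewrite -lte_fin; near: k; exact: a_small.
  by apply/ltW; near: k; exact: (near_infty_natSinv_lt (PosNum e3)).
exists u_.
  apply/cvgrPdist_le => e e0; apply: filterS (phi_small e e0) => k phik.
  by rewrite -lee_fin; apply: le_trans phik; rewrite leeDl.
apply/lee_addgt0Pr => e e0; rewrite add0e; apply: limn_esup_le.
by apply: filterS (phi_small e e0) => k; apply: le_trans; rewrite leeDr.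
Unshelve. all: by end_near. Qed.

End fixed_parameters.

Lemma mosco_cvg_at_scale (alpha : \bar R) : 0 <= alpha ->
  mosco_cvg_at (scale_functional F) alpha
    (scale_functional_bar F [set u | F u = 0] alpha).
Proof.
move=> alpha0 a a_gt0 a_alpha; split=> [u_ u|u].
  exact: scale_bar_le_limn_einf.
move: alpha0; rewrite le_eqVlt => /predU1P[alpha0|alpha0].
  have [u_ u_u limsup] := recovery_at_0 a_gt0 a_alpha u (esym alpha0).
  by exists u_; rewrite // -alpha0 /= eqxx.
exists (fun=> u); first exact: cvg_cst.
exact: (limn_esup_scale_cst a_alpha).
Qed.

End mosco.

Theorem proposition3p3 (R : realType) (n : nat) (Omega : set 'rV[R]_n)
    (oO : open Omega) (bO : bounded_set Omega)
    (Reg : L2 oO -> \bar R)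
    (Reg_ge0 : forall u, 0 <= Reg u)
    (Reg_convex : econvex Reg)
    (Reg_lsc : lower_semicontinuous Reg)
    (Reg_eq0 : forall u, Reg u = 0 <-> L2_constants u)
    (Reg_dom : dense [set u | Reg u < +oo])
    (alpha : \bar R) (alpha_ge0 : 0 <= alpha) :
  mosco_cvg_at (scale_functional Reg) alpha
    (scale_functional_bar Reg (@L2_constants R n Omega oO) alpha).
Proof.
have -> : @L2_constants R n Omega oO = [set u | Reg u = 0].
  by apply/seteqP; split=> u /Reg_eq0.
exact: mosco_cvg_at_scale.
Qed.
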